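(* Let $z$ be a generic nonzero complex number. For $a,b,c\in\mathbb{C}$ let $\mathcal{C}(a,b,c)$ be the arrangement of six lines in $\mathbb{P}^2(\mathbb{C})$ with normals $(0,a,1),(0,-a,1),(b,0,1),(-b,0,1),(c,1,0),(-c,1,0)$ (the line with normal $(\alpha,\beta,\gamma)$ being $\alpha x+\beta y+\gamma w=0$). Let $\nu_k=\tfrac13(2^k-(-1)^k)$ for $k\ge0$, and set $a_k=z^{\nu_k(-1)^k}$, $b_k=z^{\nu_k(-1)^{k+1}}=1/a_k$, $c_k=z^{\nu_k(-1)^k+1}=z a_k$. Define $\tilde{\mathcal{C}}_0=\mathcal{C}(1,1,z)$ and $\tilde{\mathcal{C}}_{k+1}=\Lambda_{\{2\},\{3\}}(\tilde{\mathcal{C}}_k)$. Then $\tilde{\mathcal{C}}_k=\mathcal{C}(a_k,b_k,c_k)$ for all $k\ge0$.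
   Context: For a line arrangement $\mathcal{A}$, a $k$-point is a point where exactly $k$ lines meet and $\mathcal{P}_{\{k\}}(\mathcal{A})$ is the set of $k$-points. For a finite point set $P$, $\mathcal{L}_{\{k\}}(P)$ is the set of lines containing exactly $k$ points of $P$. $\Lambda_{\{2\},\{3\}}(\mathcal{A})=\mathcal{L}_{\{3\}}(\mathcal{P}_{\{2\}}(\mathcal{A}))$, the union of the lines containing exactly three double points of $\mathcal{A}$. *)

(* Defs.v *)
From HB Require Import structures.
From mathcomp Require Import all_boot all_order all_algebra.
From mathcomp Require Import boolp classical_sets functions cardinality reals.
From mathcomp Require Import complex.
Set Implicit Arguments.
Unset Strict Implicit.
Unset Printing Implicit Defensive.

Import Order.TTheory GRing.Theory Num.Theory.
Local Open Scope classical_set_scope.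
Local Open Scope card_scope.
Local Open Scope ring_scope.

(* Points (resp. lines) of P^2(F) are the subspaces of F^3 of dimension 1     *)
(* (resp. 2); incidence is inclusion.                                         *)

Section ProjectivePlane.
Variable F : fieldType.
Implicit Types (A P : set {vspace 'rV[F]_3}) (k : nat).

(* The row vector (x, y, w). *)
Definition vec3 (x y w : F) : 'rV[F]_3 := \row_(i < 3) [:: x; y; w]`_i.

(* The subspace {v | alpha x + beta y + gamma w = 0}; it is a line as soon as *)
(* the normal is nonzero.                                                     *)
Definition line_of (n : 'rV[F]_3) : {vspace 'rV[F]_3} :=
  lker (linfun (mulmxr n^T) : 'Hom('rV[F]_3, 'rV[F]_1)).

Definition kpoints k A : set {vspace 'rV[F]_3} :=
  [set p | \dim p = 1%N /\ [set l | A l /\ (p <= l)%VS] #= `I_k].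

Definition klines k P : set {vspace 'rV[F]_3} :=
  [set l | \dim l = 2%N /\ [set p | P p /\ (p <= l)%VS] #= `I_k].

Definition Lambda23 A : set {vspace 'rV[F]_3} := klines 3 (kpoints 2 A).

Definition arrC (a b c : F) : set {vspace 'rV[F]_3} :=
  [set l | l \in [:: line_of (vec3 0 a 1); line_of (vec3 0 (- a) 1);
                     line_of (vec3 b 0 1); line_of (vec3 (- b) 0 1);
                     line_of (vec3 c 1 0); line_of (vec3 (- c) 1 0)]].

Definition arrCt (z : F) k : set {vspace 'rV[F]_3} :=
  iter k Lambda23 (arrC 1 1 z).

Lemma mem_line_of (x y w al be ga : F) :
  (vec3 x y w \in line_of (vec3 al be ga)) = (al * x + be * y + ga * w == 0).
Proof.
rewrite memv_ker lfunE /=; apply/eqP/eqP => [/matrixP/(_ 0 0)|H].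
  rewrite !mxE !big_ord_recr big_ord0 /= !mxE /= add0r => <-.
  by congr (_ + _ + _); rewrite mulrC.
apply/matrixP => i j; rewrite !mxE !big_ord_recr big_ord0 /= !mxE /= add0r -H.
by congr (_ + _ + _); rewrite mulrC.
Qed.

End ProjectivePlane.

(* The division is exact, see [nuE]. *)
Definition nu (k : nat) : int := ((2 ^+ k - (-1) ^+ k) %/ 3)%Z.

Lemma nuE k : 3 * nu k = 2 ^+ k - (-1) ^+ k.
Proof.
by rewrite /nu mulrC divzK // subrXX dvdz_mulr.
Qed.

Section Exponents.
Variables (F : fieldType) (z : F).

Definition ak (k : nat) : F := z ^ (nu k * (-1) ^+ k).
Definition bk (k : nat) : F := z ^ (nu k * (-1) ^+ k.+1).
Definition ck (k : nat) : F := z ^ (nu k * (-1) ^+ k + 1).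

Lemma bkE k : bk k = (ak k)^-1.
Proof. by rewrite /bk /ak exprS mulN1r mulrN -invr_expz. Qed.

Lemma ckE k : z != 0 -> ck k = z * ak k.
Proof. by move=> z0; rewrite /ck expfzDr // expr1z mulrC. Qed.

End Exponents.

(* Main.v *)
Require Import Defs.
From mathcomp Require Import all_boot all_order all_algebra reals complex.
From mathcomp Require Import classical_sets cardinality finmap.
From mathcomp Require Import zify ring.
Set Implicit Arguments.
Unset Strict Implicit.
Unset Printing Implicit Defensive.
Import GRing.Theory Num.Theory.
Local Open Scope ring_scope.

(* Scaling the axes by [b] and [a] turns C(a, b, c) into a configuration that *)
(* depends only on t = a c / b: the lines y = +-1, x = +-1, y = +-t x.  For   *)
(* generic t these are in general position, so the double points are the 15   *)
(* pairwise intersections, and the lines y = +-t, x = +-1/t, y = +-x each     *)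
(* contain exactly three of them, whereas the original lines contain five.    *)
(* Every other collinearity among the 15 points is the vanishing of an        *)
(* integer polynomial in t which is nonzero because it is nonzero at t = 2,   *)
(* so it is avoided for generic t. Hence one step maps C(a, b, c) to          *)
(* C(b/c, ac, b/a).  At step k one has t = z^e with e = 1 mod 3, so e <> 0    *)
(* and only finitely many z are excluded.                                     *)

(** A double point is the cross product of two normals, and a line through two double points has
    their cross product as normal. One step of [Lambda23] is therefore governed by which [dot]s and
    [det3]s vanish; [config] is such a certificate and [Lambda23_config] shows that it suffices.
    Computation checks it at t = 2 over the integers, and [config_transfer] carries it to every t
    off the zeros of one nonzero polynomial ([config_lines]). [Lambda23_arrC] undoes the scaling,
    [abck_succ] matches the step with the exponents, and [zeros_exprz] bounds the excluded z. *)

Section Triples.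
Variable R : comNzRingType.
Implicit Types (u v w : R * R * R) (N M P : seq (R * R * R)).

Definition dot u v : R := u.1.1 * v.1.1 + u.1.2 * v.1.2 + u.2 * v.2.

Definition cross u v : R * R * R :=
  (u.1.2 * v.2 - u.2 * v.1.2, u.2 * v.1.1 - u.1.1 * v.2,
   u.1.1 * v.1.2 - u.1.2 * v.1.1).

Definition det3 u v w : R := dot (cross u v) w.

Definition scale3 (k : R) u : R * R * R := (k * u.1.1, k * u.1.2, k * u.2).

Fixpoint crosses N : seq (R * R * R) :=
  if N is n :: N' then [seq cross n m | m <- N'] ++ crosses N' else [::].

(** A length-two subsequence encodes a pair of positions, so it matches what filtering [N]
    produces. *)
Lemma crossesP N p :
  (p \in crosses N) <-> exists n m, subseq [:: n; m] N /\ p = cross n m.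
Proof.
elim: N => [|x N IH]; first by split=> // -[n [m []]].
rewrite /= mem_cat; split=> [/orP[/mapP[m mN ->]|/IH[n [m [sN ->]]]]|].
- by exists x, m; rewrite /= eqxx sub1seq.
- exists n, m; split=> //; exact: subseq_trans sN (subseq_cons _ _).
move=> [n [m [/=]]]; case: eqP => [->|_ sN pE].
  by rewrite sub1seq => mN ->; apply/orP; left; exact: map_f.
by apply/orP; right; apply/IH; exists n, m.
Qed.

Lemma dotC u v : dot u v = dot v u.
Proof. by rewrite /dot; ring. Qed.

Lemma dot_crossl u v : dot u (cross u v) = 0.
Proof. by rewrite /dot /=; ring. Qed.

Lemma dot_crossr u v : dot v (cross u v) = 0.
Proof. by rewrite /dot /=; ring. Qed.

Lemma dot_crossC u v w : dot u (cross v w) = - dot w (cross v u).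
Proof. by rewrite /dot /=; ring. Qed.

Lemma cross0_det u v w : cross u v = 0 -> det3 u v w = 0.
Proof. by rewrite /det3 => ->; rewrite /dot /= !mul0r !addr0. Qed.

(** Vector triple product: u x (n x m) = (m.u) n - (n.u) m. *)
Lemma cross_cross n m u : dot n u = 0 -> dot m u = 0 -> cross u (cross n m) = 0.
Proof.
move=> nu mu.
suff -> : cross u (cross n m) =
    (n.1.1 * dot m u - m.1.1 * dot n u, n.1.2 * dot m u - m.1.2 * dot n u,
     n.2 * dot m u - m.2 * dot n u) by rewrite nu mu !mulr0 subrr.
by rewrite /cross /dot /=; congr (_, _, _); ring.
Qed.

(* If [P] is the list of double points of the arrangement [N], this says that *)
(* the lines with normals in [M] are the lines through exactly three points   *)
(* of [P], each condition being the vanishing or not of [dot]s and [det3]s.   *)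
Definition config N M P : bool :=
  [&& all (fun p => count (fun n => dot n p == 0) N == 2) P,
      all (fun p => has (fun n => dot n p != 0) N) P,
      all (fun m => has (fun p => dot m p != 0) P) (N ++ M),
      all (fun n => count (fun p => dot n p == 0) P != 3) N,
      all (fun m => count (fun p => dot m p == 0) P == 3) M,
      pairwise (fun p q => has (fun r => det3 p q r != 0) P) P &
      pairwise (fun p q => has (fun m => (dot m p == 0) && (dot m q == 0)) (N ++ M)
         || (count (fun r => det3 p q r == 0%R) P <= 2)%N) P].

End Triples.

Definition map3 (R S : Type) (f : R -> S) (u : R * R * R) : S * S * S :=
  (f u.1.1, f u.1.2, f u.2).

(** * Transport of the certificate along ring morphisms *)

Section Transfer.
Variables (R S : comNzRingType) (f : {rmorphism R -> S}).

Lemma dot_map3 u v : dot (map3 f u) (map3 f v) = f (dot u v).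
Proof. by rewrite /dot !rmorphD !rmorphM. Qed.

Lemma cross_map3 u v : cross (map3 f u) (map3 f v) = map3 f (cross u v).
Proof. by rewrite /cross /map3 /= !rmorphB !rmorphM. Qed.

Lemma det3_map3 u v w : det3 (map3 f u) (map3 f v) (map3 f w) = f (det3 u v w).
Proof. by rewrite /det3 cross_map3 dot_map3. Qed.

Lemma crosses_map3 N : crosses (map (map3 f) N) = map (map3 f) (crosses N).
Proof.
elim: N => //= n N ->; rewrite map_cat -!map_comp; congr (_ ++ _).
by apply: eq_map => m /=; rewrite cross_map3.
Qed.

End Transfer.

(** The [dot]s are counted exactly, so their zeros must agree; the [det3]s occur only as nonzero or
    in an upper bound, so one implication is enough. *)
Lemma config_transfer (A R S : comNzRingType) (f : {rmorphism A -> R})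
    (g : {rmorphism A -> S}) (N M P : seq (A * A * A)) :
  {in N ++ M & P, forall m p, (f (dot m p) == 0) = (g (dot m p) == 0)} ->
  {in P & &, forall p q r, f (det3 p q r) = 0 -> g (det3 p q r) = 0} ->
  config (map (map3 g) N) (map (map3 g) M) (map (map3 g) P) ->
  config (map (map3 f) N) (map (map3 f) M) (map (map3 f) P).
Proof.
move=> Hdot Hdet.
have HN n p : n \in N -> p \in P ->
    (dot (map3 f n) (map3 f p) == 0) = (dot (map3 g n) (map3 g p) == 0).
  by move=> nN pP; rewrite !dot_map3 Hdot // mem_cat nN.
have HM m p : m \in N ++ M -> p \in P ->
    (dot (map3 f m) (map3 f p) == 0) = (dot (map3 g m) (map3 g p) == 0).
  by move=> nN pP; rewrite !dot_map3 Hdot.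
have HP p q r : p \in P -> q \in P -> r \in P ->
    det3 (map3 f p) (map3 f q) (map3 f r) == 0 ->
    det3 (map3 g p) (map3 g q) (map3 g r) == 0.
  by move=> pP qP rP; rewrite !det3_map3 => /eqP/Hdet->.
rewrite /config -!map_cat !all_map !pairwise_map.
case/and5P=> c1 c2 c3 c4 /and3P[c5 c6 c7].
apply/and5P; split; last apply/and3P; last split.
- apply/allP => p pP /=; have /eqP<- := allP c1 p pP; rewrite !count_map.
  by apply/eqP/eq_in_count => n nN /=; rewrite HN.
- apply/allP => p pP; have := allP c2 p pP; rewrite /= !has_map => /hasP[n nN ne].
  by apply/hasP; exists n => //=; rewrite HN.
- apply/allP => m mM; have := allP c3 m mM; rewrite /= !has_map => /hasP[p pP ne].
  by apply/hasP; exists p => //=; rewrite HM.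
- apply/allP => n nN; have := allP c4 n nN; rewrite /= !count_map.
  apply: contraNneq => <-.
  by apply/eqP/eq_in_count => p pP /=; rewrite HN.
- apply/allP => m mM; have /eqP<- := allP c5 m mM; rewrite /= !count_map.
  by apply/eqP/eq_in_count => p pP /=; rewrite HM // mem_cat mM orbT.
- apply: (@sub_in_pairwise _ (mem P)) c6; last exact/allP.
  move=> p q pP qP /=; rewrite !has_map => /hasP[r rP ne].
  by apply/hasP; exists r => //=; apply: contra ne; exact: HP.
- apply: (@sub_in_pairwise _ (mem P)) c7; last exact/allP.
  move=> p q pP qP /=; rewrite !has_map !count_map.
  case/orP => [/hasP[m mM /andP[mp mq]]|le2].
    by apply/orP; left; apply/hasP; exists m => //=; rewrite !HM //; apply/andP.
  apply/orP; right; apply: leq_trans le2.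
  (* Membership in [P] is put into the counted predicate so that [HP] applies. *)
  under eq_in_count => r rP do rewrite -[preim _ _ r]andTb -rP.
  by apply: sub_count => r /andP[rP]; exact: HP.
Qed.

(** * Points and lines as subspaces *)

Section Geometry.
Variable F : fieldType.
Implicit Types u v : F * F * F.

Lemma parallel u v : v != 0 -> cross u v = 0 -> exists k, u = scale3 k v.
Proof.
have ratio x y x' y' : x' != 0 -> x * y' = y * x' -> y = x / x' * y' :> F.
  by move=> x0 e; rewrite mulrAC e mulfK.
case: u v => [[x y] w] [[x' y'] w'] v0.
move=> [/= /subr0_eq e1 /subr0_eq e2 /subr0_eq e3].
have [x0|x0] := eqVneq x' 0; last first.
  exists (x / x'); rewrite /scale3 /= divfK //.
  by congr (_, _, _); apply: ratio.
have [y0|y0] := eqVneq y' 0; last first.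
  exists (y / y'); rewrite /scale3 /= divfK //.
  by congr (_, _, _); apply: ratio.
have w0 : w' != 0 by apply: contraNneq v0 => w0; rewrite x0 y0 w0.
exists (w / w'); rewrite /scale3 /= divfK //.
by congr (_, _, _); apply: ratio.
Qed.

Lemma scale3_neq0 k u : scale3 k u != 0 -> k != 0.
Proof. by apply: contraNneq => ->; rewrite /scale3 !mul0r. Qed.

Lemma card_seq_pred (T : choiceType) (s : seq T) (P : pred T) k : uniq s ->
  ([set x | x \in s /\ P x] #= `I_k)%card <-> count P s = k.
Proof.
move=> us.
have -> : [set x | x \in s /\ P x]%classic = [set` [fset x in filter P s]%fset]%classic.
  apply/seteqP; split=> x /=; rewrite !inE mem_filter; first by case=> -> ->.
  by case/andP.
have <- : size (undup (filter P s)) = count P s.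
  by rewrite undup_id ?filter_uniq // size_filter.
by rewrite -card_fseq; exact: iff_sym (rwP card_eq_fsetP).
Qed.

Lemma kpoints_seq (s : seq {vspace 'rV[F]_3}) k : uniq s ->
  kpoints k [set` s]%classic =
  [set p : {vspace _} | \dim p = 1%N /\ count (fun l => (p <= l)%VS) s = k]%classic.
Proof.
move=> us; apply/seteqP; split=> p /= -[dp]; move=> H; split=> //.
  exact/(card_seq_pred _ _ us).
exact/(card_seq_pred (fun l => (p <= l)%VS) _ us).
Qed.

Lemma klines_seq (s : seq {vspace 'rV[F]_3}) k : uniq s ->
  klines k [set` s]%classic =
  [set l : {vspace _} | \dim l = 2%N /\ count (fun p => (p <= l)%VS) s = k]%classic.
Proof.
move=> us; apply/seteqP; split=> l /= -[dl]; move=> H; split=> //.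
  exact/(card_seq_pred _ _ us).
exact/(card_seq_pred (fun p => (p <= l)%VS) _ us).
Qed.

Lemma vec3E (v : 'rV[F]_3) : v = vec3 (v 0 0) (v 0 1) (v 0 2%:R).
Proof.
apply/rowP => -[[|[|[|//]]] i]; rewrite mxE /=; congr (v _ _); exact: val_inj.
Qed.

Lemma vec3Z k x y w : vec3 (k * x) (k * y) (k * w) = k *: vec3 x y w :> 'rV[F]_3.
Proof. by apply/rowP => -[[|[|[|//]]] i]; rewrite !mxE. Qed.

Lemma vec3_eq0 x y w : (vec3 x y w == 0 :> 'rV[F]_3) = ((x, y, w) == 0).
Proof.
apply/eqP/eqP => [/rowP e|[-> -> ->]].
  by have := (e 0, e 1, e 2%:R); rewrite !mxE /= => -[[-> ->] ->].
by apply/rowP => -[[|[|[|//]]] i]; rewrite !mxE.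
Qed.

Lemma line_ofZ k (n : 'rV[F]_3) : k != 0 -> line_of (k *: n) = line_of n.
Proof.
move=> k0; apply/vspaceP => v; rewrite (vec3E v) (vec3E n) -vec3Z !mem_line_of.
by rewrite -!mulrA -!mulrDr mulf_eq0 (negPf k0).
Qed.

(** Rank-nullity: the functional has rank one, since its values on the basis vectors are the
    coordinates of [n]. *)
Lemma dim_line_of (n : 'rV[F]_3) : n != 0 -> \dim (line_of n) = 2%N.
Proof.
move=> n0; set f : 'Hom('rV[F]_3, 'rV[F]_1) := linfun (mulmxr n^T).
have := limg_ker_dim f fullv.
rewrite capfv dimvf dim_matrix.
have : (\dim (limg f) <= 1)%N.
  by rewrite (leq_trans (dimvS (subvf _))) // dimvf dim_matrix.
have : \dim (limg f) != 0%N.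
  rewrite dimv_eq0 -subv0; apply: contra n0 => /subvP H.
  apply/eqP/rowP => i; rewrite mxE.
  have := H _ (memv_img f (memvf (delta_mx 0 i))).
  rewrite memv0 lfunE /= => /eqP/matrixP/(_ 0 0).
  by rewrite -rowE !mxE.
by rewrite -/(line_of n); case: (\dim (limg f)) => [|[|]] // _ _; rewrite addn1 => -[].
Qed.

End Geometry.

Lemma pairwise_subseq (T : eqType) (r : rel T) s :
  (forall x y, subseq [:: x; y] s -> r x y) -> pairwise r s.
Proof.
elim: s => //= x s IH xy; rewrite IH ?andbT => [|y z yz].
  by apply/allP => y ys; apply: xy; rewrite eqxx sub1seq.
by apply: xy; case: eqP => // _; exact: subseq_trans (subseq_cons _ _) yz.
Qed.

(** * Dictionary between triples and subspaces *)

Section Scaled.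
Variables (F : fieldType) (a b : F).
Hypotheses (a0 : a != 0) (b0 : b != 0).
Implicit Types (u v n m p q : F * F * F) (N M P : seq (F * F * F)).

(* Incidence of [ptS u] and [lnS n] is [dot n u == 0]: the scalings cancel. *)
Definition lnS n : {vspace 'rV[F]_3} := line_of (vec3 (b * n.1.1) (a * n.1.2) n.2).
Definition ptS u : {vspace 'rV[F]_3} := <[vec3 (u.1.1 / b) (u.1.2 / a) u.2]>%VS.

Lemma mem_ptS u n : (ptS u <= lnS n)%VS = (dot n u == 0).
Proof.
rewrite -memvE mem_line_of /dot; congr (_ == 0); by field; rewrite a0 b0.
Qed.

Lemma lnSZ k n : k != 0 -> lnS (scale3 k n) = lnS n.
Proof. by move=> k0; rewrite /lnS /= !(mulrCA _ k) vec3Z line_ofZ. Qed.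

Lemma ptSZ k u : k != 0 -> ptS (scale3 k u) = ptS u.
Proof.
move=> k0; rewrite /ptS /= -!mulrA vec3Z; apply/eqP; rewrite eqEdim.
rewrite !dim_vline scaler_eq0 (negPf k0) leqnn andbT -memvE.
by rewrite memvZ ?memv_line.
Qed.

Lemma dim_lnS n : n != 0 -> \dim (lnS n) = 2%N.
Proof.
case: n => [[x y] w] n0; apply: dim_line_of; rewrite vec3_eq0.
apply: contra n0 => /eqP[/= /eqP + /eqP + ->].
by rewrite !mulf_eq0 (negPf a0) (negPf b0) => /eqP-> /eqP->.
Qed.

Lemma dim_ptS u : u != 0 -> \dim (ptS u) = 1%N.
Proof.
case: u => [[x y] w] u0; rewrite dim_vline.
suff /negPf-> : vec3 (x / b) (y / a) w != 0 by [].
rewrite vec3_eq0; apply: contra u0 => /eqP[/eqP + /eqP + ->].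
by rewrite !mulf_eq0 !invr_eq0 (negPf a0) (negPf b0) !orbF => /eqP-> /eqP->.
Qed.

Lemma dim1_ptS (p : {vspace 'rV[F]_3}) : \dim p = 1%N -> exists2 u, u != 0 & p = ptS u.
Proof.
move=> dp; set v := vpick p.
have v0 : v != 0 by rewrite vpick0 -dimv_eq0 dp.
have pv : p = <[v]>%VS.
  by apply/eqP; rewrite eq_sym eqEdim -memvE memv_pick dim_vline v0 dp.
exists (b * v 0 0, a * v 0 1, v 0 2%:R).
  apply: contra v0 => /eqP[/eqP + /eqP + v2].
  rewrite !mulf_eq0 (negPf a0) (negPf b0) => /eqP v0 /eqP v1.
  by rewrite (vec3E v) vec3_eq0 v0 v1 v2.
by rewrite /ptS /= ![_ * _ / _]mulrAC !divff // !mul1r -vec3E.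
Qed.

Lemma ptS_eq n m u : u != 0 -> cross n m != 0 -> dot n u = 0 -> dot m u = 0 ->
  ptS u = ptS (cross n m).
Proof.
move=> u0 nm0 nu mu; have [k uE] := parallel nm0 (cross_cross nu mu).
by move: u0; rewrite uE => /scale3_neq0; exact: ptSZ.
Qed.

Lemma lnS_eq n p q : n != 0 -> cross p q != 0 -> dot n p = 0 -> dot n q = 0 ->
  lnS n = lnS (cross p q).
Proof.
rewrite ![dot n _]dotC => u0 nm0 nu mu.
have [k uE] := parallel nm0 (cross_cross nu mu).
by move: u0; rewrite uE => /scale3_neq0; exact: lnSZ.
Qed.

(** Split [l] as a point plus a complementary point; their cross product is a normal. *)
Lemma dim2_lnS (l : {vspace 'rV[F]_3}) : \dim l = 2%N -> exists2 n, n != 0 & l = lnS n.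
Proof.
move=> dl.
have [u u0 ul] : exists2 u, u != 0 & (ptS u <= l)%VS.
  have v0 : vpick l != 0 by rewrite vpick0 -dimv_eq0 dl.
  have [|u u0 e] := @dim1_ptS <[vpick l]>%VS; first by rewrite dim_vline v0.
  by exists u => //; rewrite -e -memvE memv_pick.
have capu : (l :&: ptS u)%VS = ptS u by apply/capv_idPr.
have [v v0 vE] : exists2 v, v != 0 & (l :\: ptS u)%VS = ptS v.
  apply: dim1_ptS; apply/eqP; rewrite -(eqn_add2l 1) -{1}(dim_ptS u0) -{1}capu.
  by rewrite dimv_cap_compl dl.
have lE : l = (ptS v + ptS u)%VS by rewrite -vE -{2}capu addv_diff_cap.
have c0 : cross u v != 0.
  apply/eqP => /(parallel v0)[k uE].
  have vu : ptS v = ptS u.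
    by move: u0; rewrite uE => /scale3_neq0 k0; rewrite ptSZ.
  have /eqP := capv_diff l (ptS u).
  by rewrite vE vu capvv -dimv_eq0 dim_ptS.
exists (cross u v) => //; apply/eqP; rewrite eqEdim dl dim_lnS // andbT.
by rewrite lE subv_add !mem_ptS dotC dot_crossr dotC dot_crossl eqxx.
Qed.

(** If [n] and [m] gave the same line, every [dot k (cross n m)] would vanish. *)
Lemma uniq_lnS N : all (fun p => has (fun n => dot n p != 0) N) (crosses N) ->
  uniq (map lnS N).
Proof.
move=> /allP spread; rewrite uniq_pairwise pairwise_map; apply: pairwise_subseq.
move=> n m nm; have /spread/hasP[k _] : cross n m \in crosses N.
  by apply/crossesP; exists n, m.
apply: contra => /eqP e; rewrite dot_crossC oppr_eq0.
by rewrite -mem_ptS -e mem_ptS dot_crossl.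
Qed.

Lemma uniq_ptS P : pairwise (fun p q => has (fun r => det3 p q r != 0) P) P ->
  uniq (map ptS P).
Proof.
move=> spread; rewrite uniq_pairwise pairwise_map; apply: sub_pairwise spread.
move=> p q /hasP[r _]; apply: contra => /eqP e.
rewrite /det3 dotC dot_crossC oppr_eq0 dotC.
by rewrite -mem_ptS -e mem_ptS dotC dot_crossl.
Qed.

Lemma count_lnS N u :
  count (fun l => (ptS u <= l)%VS) (map lnS N) = count (fun n => dot n u == 0) N.
Proof. by rewrite count_map; apply: eq_count => n /=; rewrite mem_ptS. Qed.

Lemma count_ptS P n :
  count (fun l => (l <= lnS n)%VS) (map ptS P) = count (fun p => dot n p == 0) P.
Proof. by rewrite count_map; apply: eq_count => p /=; rewrite mem_ptS. Qed.

Lemma kpoints2_lnS N :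
  all (fun p => count (fun n => dot n p == 0) N == 2) (crosses N) ->
  all (fun p => has (fun n => dot n p != 0) N) (crosses N) ->
  kpoints 2 [set` map lnS N]%classic = [set` map ptS (crosses N)]%classic.
Proof.
move=> /allP two spread; rewrite kpoints_seq ?uniq_lnS //.
have cross0 p : p \in crosses N -> p != 0.
  move=> /(allP spread)/hasP[n _]; apply: contra => /eqP->.
  by rewrite /dot /= !mulr0 !addr0.
apply/seteqP; split=> [_ [/dim1_ptS[u u0 ->]] | _ /mapP[p pN ->]] /=; last first.
  by rewrite dim_ptS ?cross0 // count_lnS; split=> //; exact/eqP/two.
rewrite count_lnS -size_filter => sz.
have := filter_subseq (fun n => dot n u == 0) N.
have := filter_all (fun n => dot n u == 0) N.
case: filter sz => [|n [|m []]] // _ /= /and3P[/eqP nu /eqP mu _] nm.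
have nmN : cross n m \in crosses N by apply/crossesP; exists n, m.
by apply/mapP; exists (cross n m) => //; apply: ptS_eq => //; apply: cross0.
Qed.

Lemma Lambda23_config N M : config N M (crosses N) ->
  Lambda23 [set` map lnS N]%classic = [set` map lnS M]%classic.
Proof.
rewrite /config; set P := crosses N.
case/and5P => two spreadN /allP ne0 /allP N3 /and3P[/allP M3 spreadP det_le2].
have n0 n : n \in N ++ M -> n != 0.
  move=> /ne0/hasP[p _]; apply: contra => /eqP->.
  by rewrite /dot /= !mul0r !addr0.
rewrite /Lambda23 kpoints2_lnS // klines_seq ?uniq_ptS //.
apply/seteqP; split=> [l [/dim2_lnS[n nn0 ->]] | _ /mapP[m mM ->]] /=; last first.
  rewrite dim_lnS; last by rewrite n0 // mem_cat mM orbT.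
  by rewrite count_ptS; split=> //; exact/eqP/M3.
move=> sz; have := sz; rewrite count_ptS -size_filter => sz'.
have := filter_subseq (fun p => dot n p == 0) P.
have := filter_all (fun p => dot n p == 0) P.
case: filter sz' => [|p [|q [|r []]]] // _ /and4P[/eqP np /eqP nq _ _] pqr.
have pq : subseq [:: p; q] P.
  exact: subseq_trans (prefix_subseq [:: p; q] [:: r]) pqr.
have := subseq_pairwise pq spreadP; rewrite pairwise2 => /hasP[s _ s0].
have pq0 : cross p q != 0.
  by apply: contra s0 => /eqP/cross0_det->.
(* The line is spanned by its first two points. Either it lies in [N ++ M], and [N] is ruled out by
   the count of three, or it holds at most two points. *)
have nE := lnS_eq nn0 pq0 np nq.
have := subseq_pairwise pq det_le2; rewrite pairwise2.
case/orP => [/hasP[m mNM /andP[/eqP mp /eqP mq]]|].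
  have nm : lnS n = lnS m by rewrite nE (lnS_eq _ pq0 mp mq) // n0.
  apply/mapP; exists m => //; move: mNM; rewrite mem_cat => /orP[mN|//].
  by have := N3 m mN; rewrite -count_ptS -nm sz.
suff -> : count (fun x => det3 p q x == 0) P = 3%N by [].
by rewrite -count_ptS -nE.
Qed.

End Scaled.

(** * The one-parameter family of six lines *)

Section Arrangement.
(* In the coordinates (b x : a y : w), the normals of C(a, b, c) and of       *)
(* C(b/c, ac, b/a), where t = a c / b.                                        *)
Variable R : comNzRingType.
Implicit Type t : R.

Definition lines t : seq (R * R * R) :=
  [:: (0, 1, 1); (0, -1, 1); (1, 0, 1); (-1, 0, 1); (t, 1, 0); (- t, 1, 0)].

Definition lines_next t : seq (R * R * R) :=
  [:: (0, 1, t); (0, -1, t); (t, 0, 1); (- t, 0, 1); (1, 1, 0); (-1, 1, 0)].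

End Arrangement.

Lemma map3_lines (R S : comNzRingType) (f : {rmorphism R -> S}) t :
  map (map3 f) (lines t) = lines (f t).
Proof. by rewrite /= /map3 /= !rmorphN rmorph0 rmorph1. Qed.

Lemma map3_lines_next (R S : comNzRingType) (f : {rmorphism R -> S}) t :
  map (map3 f) (lines_next t) = lines_next (f t).
Proof. by rewrite /= /map3 /= !rmorphN rmorph0 rmorph1. Qed.

Lemma config_lines_at2 : config (lines (2 : int)) (lines_next 2) (crosses (lines 2)).
Proof. by vm_compute. Qed.

(* The 48 incidences that hold at t = 2 are polynomial identities in t. *)
Lemma incidence (R : comNzRingType) (t : R) i j :
  (i < 12)%N -> (j < 15)%N ->
  dot (nth (0, 0, 0) (lines 2 ++ lines_next 2) i)
      (nth (0, 0, 0) (crosses (lines 2)) j) = 0 :> int ->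
  dot (nth (0, 0, 0) (lines t ++ lines_next t) i)
      (nth (0, 0, 0) (crosses (lines t)) j) = 0.
Proof.
do 12 (case: i => [_|i]; [do 15 (case: j => [_ e|j];
  (* Either computation refutes the incidence at 2, or [ring] proves it for all [t]. *)
  [first [by move: e; vm_compute | rewrite /dot /=; ring]|]); by []|]).
by [].
Qed.

(** * Genericity in t *)

Definition evalz (F : comNzRingType) (t : F) : {rmorphism {poly int} -> F} :=
  (horner_eval t \o map_poly (intr : int -> F)).

Lemma evalzX (F : comNzRingType) (t : F) : evalz t 'X = t.
Proof. by rewrite /= map_polyX /horner_eval hornerX. Qed.

(** Take the product of the nonzero members of [s]; characteristic zero keeps their images
    nonzero. *)
Lemma generic_nonzero (F : numFieldType) (s : seq {poly int}) :
  exists2 D : {poly F}, D != 0 &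
    forall t, D.[t] != 0 -> {in s, forall q, evalz t q = 0 -> q = 0}.
Proof.
exists (\prod_(q <- s | q != 0) map_poly intr q).
  rewrite prodf_seq_neq0; apply/allP => q _; apply/implyP => q0.
  by rewrite map_poly_eq0_id0 // intr_eq0 lead_coef_eq0.
move=> t; rewrite horner_prod prodf_seq_neq0 => /allP Ht q qs q0.
apply/eqP; apply: contraT => qn0.
by have /implyP/(_ qn0) := Ht q qs; rewrite [_.[_]]q0 eqxx.
Qed.

Lemma config_lines (F : numFieldType) :
  exists2 D : {poly F}, D != 0 &
    forall t, D.[t] != 0 -> config (lines t) (lines_next t) (crosses (lines t)).
Proof.
pose N := lines ('X : {poly int}); pose M := lines_next ('X : {poly int}).
pose P := crosses N.
(* The list holds every quantity tested by [config], at the indeterminate. *)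
have [D D0 Dt] := generic_nonzero F ([seq dot m p | m <- N ++ M, p <- P] ++
    [seq det3 pq.1 pq.2 r | pq <- [seq (p, q) | p <- P, q <- P], r <- P]).
exists D => // t /Dt tests.
have NE (S : comNzRingType) (x : S) : lines x = map (map3 (evalz x)) N.
  by rewrite map3_lines evalzX.
have ME (S : comNzRingType) (x : S) : lines_next x = map (map3 (evalz x)) M.
  by rewrite map3_lines_next evalzX.
have PE (S : comNzRingType) (x : S) : crosses (lines x) = map (map3 (evalz x)) P.
  by rewrite NE crosses_map3.
rewrite PE NE ME; apply: (@config_transfer _ _ _ _ (evalz (2 : int))).
- move=> m p mNM pP; apply/eqP/eqP => [/tests->|].
  + by rewrite rmorph0.
  + by rewrite mem_cat allpairs_f.
  have /(nthP (0, 0, 0))[i ilt <-] := mNM; have /(nthP (0, 0, 0))[j jlt <-] := pP.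
  have nth3 (S : comNzRingType) (x : S) s k : (k < size s)%N ->
      map3 (evalz x) (nth (0, 0, 0) s k) = nth (0, 0, 0) (map (map3 (evalz x)) s) k.
    by move=> ks; rewrite (nth_map (0, 0, 0)).
  rewrite -!dot_map3 !nth3 // -!PE !(map_cat _ N M) -!NE -!ME.
  exact: incidence.
- move=> p q r pP qP rP /tests->; first by rewrite rmorph0.
  rewrite mem_cat; apply/orP; right.
  apply: (allpairs_f (fun pq r => det3 pq.1 pq.2 r) (x := (p, q))) => //.
  exact: allpairs_f.
- by rewrite -NE -ME -PE; exact: config_lines_at2.
Qed.

Lemma arrC_lines (F : fieldType) (a b c : F) : a != 0 -> b != 0 ->
  arrC a b c = [set` map (lnS a b) (lines (a * c / b))]%classic.
Proof.
move=> a0 b0.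
have e5 x : line_of (vec3 (a * x) a 0) = line_of (vec3 x 1 0).
  by rewrite -[a in vec3 _ a _]mulr1 -[0 in LHS](mulr0 a) vec3Z line_ofZ.
rewrite /arrC /= /lnS /= !(mulr0, mulr1, mulrN1, mulrN) [b * _]mulrC (divfK b0).
by rewrite -mulrN !e5.
Qed.

(** Normalising the scaled normals divides the first pair by [t] and the last by [a]; then a/t = b/c
    and b t = a c. *)
Lemma arrC_lines_next (F : fieldType) (a b c : F) : a != 0 -> b != 0 -> c != 0 ->
  arrC (b / c) (a * c) (b / a) = [set` map (lnS a b) (lines_next (a * c / b))]%classic.
Proof.
move=> a0 b0 c0; set t := a * c / b.
have t0 : t != 0 by rewrite !mulf_neq0 ?invr_eq0.
have e1 x : line_of (vec3 0 (t * x) t) = line_of (vec3 0 x 1).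
  by rewrite -[t in vec3 _ _ t]mulr1 -[0 in LHS](mulr0 t) vec3Z line_ofZ.
have e5 x : line_of (vec3 (a * x) a 0) = line_of (vec3 x 1 0).
  by rewrite -[a in vec3 _ a _]mulr1 -[0 in LHS](mulr0 a) vec3Z line_ofZ.
have ta : t * (b / c) = a by rewrite /t; field; rewrite c0 b0.
rewrite /arrC /= /lnS /= !(mulr0, mulr1, mulrN1, mulrN) -!e1 -!e5.
by rewrite !mulrN ta [b * t]mulrC [a * (b / a)]mulrC !divfK.
Qed.

Lemma Lambda23_arrC (F : numFieldType) :
  exists2 D : {poly F}, D != 0 & forall a b c, a != 0 -> b != 0 -> c != 0 ->
    D.[a * c / b] != 0 -> Lambda23 (arrC a b c) = arrC (b / c) (a * c) (b / a).
Proof.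
have [D D0 HD] := config_lines F; exists D; first exact: D0.
move=> a b c a0 b0 c0 /HD cfg.
rewrite arrC_lines // (Lambda23_config a0 b0 cfg).
by rewrite arrC_lines_next.
Qed.

(** * Finite exceptional sets and the exponent recurrence *)

Lemma zeros_exprz (F : closedFieldType) (D : {poly F}) (e : int) : D != 0 -> e != 0 ->
  {s : seq F | forall z, z != 0 -> D.[z ^ e] = 0 -> z \in s}.
Proof.
move=> D0.
have zeros_expr n : {s : seq F | forall z, D.[z ^+ n.+1] = 0 -> z \in s}.
  pose q := D \Po 'X^(n.+1).
  have q0 : q != 0 by rewrite comp_poly_eq0 // size_polyXn.
  have [s qE] := closed_field_poly_normal q; exists s => z Dz.
  have : root q z by rewrite /root horner_comp hornerXn Dz.
  by rewrite qE rootZ ?lead_coef_eq0 // root_prod_XsubC.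
case: e => [[|n]|n] // _; have [s zs] := zeros_expr n.
  by exists s => z _ /zs.
(* For negative exponents 1/z is the root, so the list is inverted. *)
exists (map GRing.inv s) => z z0; rewrite NegzE -exprz_inv => /zs.
by move/(map_f GRing.inv); rewrite invrK.
Qed.

(** This is [nu k.+1 = 2 * nu k + (-1) ^+ k] up to sign; fixing the sign makes it linear. *)
Lemma nu_succ k : nu k.+1 * (-1) ^+ k.+1 = - (2 * (nu k * (-1) ^+ k) + 1).
Proof.
have := nuE k; have := nuE k.+1; rewrite !exprS.
have /eqP := sqrr_sign int k; rewrite sqrf_eq1 => /orP[/eqP->|/eqP->].
all: lia.
Qed.

Lemma abck_succ (F : fieldType) (z : F) k : z != 0 ->
  [/\ ak z k.+1 = bk z k / ck z k, bk z k.+1 = ak z k * ck z k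
    & ck z k.+1 = bk z k / ak z k].
Proof.
move=> z0.
have nuN m : nu m * (-1) ^+ m.+1 = - (nu m * (-1) ^+ m).
  by rewrite exprS mulN1r mulrN.
rewrite /ak /bk /ck !nuN nu_succ !invr_expz -!expfzDr //.
by split; congr (z ^ _); ring.
Qed.

(* "z generic": z avoids the finite sets E 0, E 1, E 2, ...; the equality at
   step k only needs z to avoid the finitely many points of E 0, ..., E k. *)
Theorem theorem2p5 (R : realType) :
  exists E : nat -> seq R[i],
    forall z : R[i], z != 0 ->
    forall k : nat, (forall j : nat, (j <= k)%N -> z \notin E j) ->
      arrCt z k = arrC (ak z k) (bk z k) (ck z k).
Proof.
have [D D0 HD] := Lambda23_arrC R[i].
(* The exponent of z in t = a c / b at step [k]. *)
pose e k : int := 3 * (nu k * (-1) ^+ k) + 1.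
have e0 k : e k != 0.
  rewrite /e; move: (nu k * _) => m; lia.
exists (fun k => sval (zeros_exprz D0 (e0 k))) => z z0.
elim=> [|k IH] zE.
  by rewrite /arrCt /ak /bk /ck /nu /= !(mul0r, add0r) expr0z expr1z.
have [aS bS cS] := abck_succ k z0.
rewrite /arrCt iterS -/(arrCt z k) IH => [|j jk]; last exact/zE/leqW.
rewrite aS bS cS; apply: HD; [exact: expfz_neq0..|].
have -> : ak z k * ck z k / bk z k = z ^ e k.
  rewrite /ak /bk /ck /e invr_expz -!expfzDr //; congr (z ^ _).
  by rewrite exprS; ring.
apply: contra (zE k (leqnSn k)) => /eqP.
exact: (svalP (zeros_exprz D0 (e0 k)) z z0).
Qed.
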